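(* Let $A\in\mathbb{C}^{n\times n}$ be Hermitian with eigenvalues $\lambda_1,\dots,\lambda_n$ contained in $[\lambda_{\min},\lambda_{\max}]$, $\lambda_{\min}<\lambda_{\max}$, and let $l(x)=\frac{2x-\lambda_{\max}-\lambda_{\min}}{\lambda_{\max}-\lambda_{\min}}$. Let $[a,b]\subset[\lambda_{\min},\lambda_{\max}]$ with $a<b$, and set $\alpha=\arccos(l(a))$, $\beta=\arccos(l(b))$. Let $s(x)=1$ for $x\in(a,b)$, $s(x)=\tfrac12$ for $x\in\{a,b\}$, $s(x)=0$ otherwise, and let $P=s(A)$. Let $c_0=\frac1\pi(\alpha-\beta)$, $c_j=\frac{2}{\pi}\cdot\frac{\sin(j\alpha)-\sin(j\beta)}{j}$ ($j\ge1$), and for $m>0$ and integers $k\ge1$ let $d^m_{0,k}=1$, $d^m_{j,k}=\left(\frac{\sin(j\pi/(k+1))}{j\pi/(k+1)}\right)^m$ ($j\ge1$). For an integer $1\le k'\le k$ let \[ \rho^m_{k',k}(x)=\sum_{j=0}^{k'} c_j\,d^m_{j,k}\,T_j(l(x)), \] where $T_j$ is the $j$-th Chebyshev polynomial of the first kind, and let $P'=\rho^m_{k',k}(A)$. Then for every $m>0$, every integer $k\ge1$ and every integer $1\le k'\le k$, \[ \|P-P'\|_2\le \frac{d^m_{k',k}\,J^*}{\pi(k'+1)}+\frac{m\,\mathcal{C}_m\,J^*}{k+1}+\frac{m\pi^2}{3(k+1)^2}, \] where $J^*=\max_{1\le j\le n}J(\arccos(l(\lambda_j)))$, \[ \mathcal{C}_m=\int_0^{\pi}\frac{(\sin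 u)^{m-1}(\sin u-u\cos u)}{u^{m+2}}\,du, \] and for $\theta\in[0,\pi]$ \[ J(\theta)=\begin{cases} \frac{1}{|\sin\frac{\theta+\alpha}{2}|}+\frac{1}{|\sin\frac{\theta-\alpha}{2}|}+\frac{1}{|\sin\frac{\theta+\beta}{2}|}+\frac{1}{|\sin\frac{\theta-\beta}{2}|}, & \theta\ne\alpha,\beta,\\[4pt] \frac{1}{|\sin\alpha|}+\frac{1}{|\sin\frac{\alpha+\beta}{2}|}+\frac{1}{|\sin\frac{\alpha-\beta}{2}|}, & \theta=\alpha,\\[4pt] \frac{1}{|\sin\beta|}+\frac{1}{|\sin\frac{\alpha+\beta}{2}|}+\frac{1}{|\sin\frac{\alpha-\beta}{2}|}, & \theta=\beta. \end{cases} \]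
   Context: For a Hermitian $A=V\Lambda V^*$ and a real function $f$, $f(A)=V f(\Lambda)V^*$. Any term of the form $1/0$ in $J$ is interpreted as $+\infty$, in which case the bound holds trivially. $P$ is the spectral projector onto the invariant subspace for eigenvalues in $[a,b]$ (with weight $\tfrac12$ for eigenvalues equal to $a$ or $b$). *)

(* Defs.v *)
From HB Require Import structures.
From mathcomp Require Import all_boot all_order all_algebra.
From mathcomp Require Import all_classical all_reals all_analysis.
From mathcomp Require Import complex sesquilinear spectral.

Set Implicit Arguments.
Unset Strict Implicit.
Unset Printing Implicit Defensive.

Import Order.TTheory GRing.Theory Num.Theory.
Local Open Scope ring_scope.

Definition lmap (R : realType) (lmin lmax x : R) : R :=
  (2 * x - lmax - lmin) / (lmax - lmin).

Definition s_step (R : realType) (a b x : R) : R :=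
  if (a < x) && (x < b) then 1
  else if (x == a) || (x == b) then 2^-1 else 0.

Fixpoint cheb_pair (R : realType) (j : nat) (x : R) : R * R :=
  match j with
  | 0%N => (1, x)
  | j'.+1 => let p := cheb_pair j' x in (p.2, 2 * x * p.2 - p.1)
  end.
Definition chebT (R : realType) (j : nat) (x : R) : R := (cheb_pair j x).1.

Definition ccoef (R : realType) (alpha beta : R) (j : nat) : R :=
  if j == 0%N then (alpha - beta) / pi
  else 2 / pi * ((sin (j%:R * alpha) - sin (j%:R * beta)) / j%:R).

Definition dcoef (R : realType) (m : R) (j k : nat) : R :=
  if j == 0%N then 1
  else powR (sin (j%:R * pi / k.+1%:R) / (j%:R * pi / k.+1%:R)) m.

Definition rho (R : realType) (lmin lmax a b m : R) (k' k : nat) (x : R) : R :=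
  let alpha := acos (lmap lmin lmax a) in
  let beta := acos (lmap lmin lmax b) in
  \sum_(j < k'.+1) ccoef alpha beta j * dcoef m j k * chebT j (lmap lmin lmax x).

(* functional calculus: f(A) = V f(Lambda) V^*, for A = V Lambda V^* *)
Definition mxfun (R : realType) (n : nat) (f : R -> R)
    (V : 'M[R[i]]_n) (lam : 'rV[R]_n) : 'M[R[i]]_n :=
  V *m diag_mx (map_mx (fun x => (f x)%:C%C) lam) *m (map_mx Num.conj V)^T.

Definition vnorm2 (R : realType) (n : nat) (x : 'cV[R[i]]_n) : R :=
  Num.sqrt (\sum_i (complex.Re (x i 0) ^+ 2 + complex.Im (x i 0) ^+ 2)).

Definition specnorm (R : realType) (n : nat) (M : 'M[R[i]]_n) : R :=
  sup [set vnorm2 (M *m x) | x in [set x : 'cV[R[i]]_n | vnorm2 x = 1]]%classic.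

Definition einv (R : realType) (x : R) : \bar R :=
  if x == 0 then +oo%E else (x^-1)%:E.

Definition Jfun (R : realType) (alpha beta theta : R) : \bar R :=
  if theta == alpha then
    (einv `|sin alpha| + einv `|sin ((alpha + beta) / 2)|
     + einv `|sin ((alpha - beta) / 2)|)%E
  else if theta == beta then
    (einv `|sin beta| + einv `|sin ((alpha + beta) / 2)|
     + einv `|sin ((alpha - beta) / 2)|)%E
  else
    (einv `|sin ((theta + alpha) / 2)| + einv `|sin ((theta - alpha) / 2)|
     + einv `|sin ((theta + beta) / 2)| + einv `|sin ((theta - beta) / 2)|)%E.

Definition Cm (R : realType) (m : R) : \bar R :=
  (\int[@lebesgue_measure R]_(u in `[0%R, pi]%classic)
     (powR (sin u) (m - 1) * (sin u - u * cos u) / powR u (m + 2))%:E)%E.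

(* Main.v *)
(* Since V is unitary, the spectral norm is the maximum over the eigenvalues of
   |s - rho|.  With theta = arccos (l x), the term c_j T_j(l x) equals 1 / (pi j)
   times a signed sum of the four sines sin (j (theta +- alpha)),
   sin (j (theta +- beta)), so s - rho is a combination of four errors
   sigma(t) - sum_(j <= k') d_j sin (j t) / j, with sigma(t) = sum_j sin (j t) / j
   the sawtooth function.  By Abel summation each error is at most
   V / (2 |sin (t / 2)|), with V the total variation of the coefficients
   (1 - d_j 1_(j <= k')) / j.  These split into d_j 1_(j > k') / j, of variation at
   most 2 d_k' / (k' + 1), and (1 - d_j) / j = h g(j h), with h = pi / (k + 1) and
   g(x) = (1 - D x) / x, D x = (sin x / x)^m.  As g y - g x <= (D x - D y) / y
   <= m int_x^y of the integrand of C_m =: m I, we have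
   |g y - g x| <= 2 m I - (g y - g x), which telescopes to a variation of at most
   2 m C_m, including that of 1 / x beyond pi. *)
Require Import Defs.
From HB Require Import structures.
From mathcomp Require Import all_boot all_order all_algebra.
From mathcomp Require Import all_classical all_reals all_analysis.
From mathcomp Require Import complex sesquilinear spectral.
From mathcomp Require Import measurable_realfun ring lra.
Set Implicit Arguments.
Unset Strict Implicit.
Unset Printing Implicit Defensive.
Import Order.TTheory GRing.Theory Num.Theory.
Import numFieldNormedType.Exports.
Local Open Scope ring_scope.

(** * Sawtooth series and Abel summation *)

Lemma chebT_cos (R : realType) (j : nat) (t : R) : chebT j (cos t) = cos (j%:R * t).
Proof.
rewrite /chebT.
suff -> : cheb_pair j (cos t) = (cos (j%:R * t), cos (j.+1%:R * t)) by [].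
elim: j => [|j IH] /=; first by rewrite mul0r cos0 mul1r.
rewrite IH /=; congr pair.
have -> : j.+2%:R * t = j.+1%:R * t + t by rewrite -[j.+2%:R]natr1; ring.
have -> : j%:R * t = j.+1%:R * t - t by rewrite -[j.+1%:R]natr1; ring.
rewrite cosB cosD; ring.
Qed.

Lemma sin_mul_sin_half (R : realType) (j : nat) (t : R) :
  2 * sin (t / 2) * sin (j.+1%:R * t) =
  cos ((j%:R + 2^-1) * t) - cos ((j.+1%:R + 2^-1) * t).
Proof.
have -> : (j%:R + 2^-1) * t = j.+1%:R * t - t / 2 by rewrite -natr1; field.
have -> : (j.+1%:R + 2^-1) * t = j.+1%:R * t + t / 2 by field.
rewrite cosB cosD; ring.
Qed.

(** Summation by parts: [sin_mul_sin_half] turns [2 sin (t / 2) sin (j t)] into a difference of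
    consecutive cosines, and [u 0 = 0] removes the boundary term at 0. *)
Lemma abel_sin_sum (R : realType) (u : nat -> R) (N : nat) (t : R) : u 0%N = 0 ->
  2 * sin (t / 2) * (\sum_(j < N) u j.+1 * sin (j.+1%:R * t)) + u N * cos ((N%:R + 2^-1) * t)
  = \sum_(j < N) (u j.+1 - u j) * cos ((j%:R + 2^-1) * t).
Proof.
move=> u0; elim: N => [|N IH]; first by rewrite !big_ord0 u0 mulr0 mul0r addr0.
rewrite !big_ord_recr /= -IH mulrDr.
have := sin_mul_sin_half N t; set s := sin (N.+1%:R * t) => h.
rewrite (_ : _ * (u N.+1 * s) = u N.+1 * (2 * sin (t / 2) * s)); last by ring.
rewrite h; ring.
Qed.

Lemma abel_sin_bound (R : realType) (u : nat -> R) (N : nat) (t : R) : u 0%N = 0 ->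
  2 * `|sin (t / 2)| * `|\sum_(j < N) u j.+1 * sin (j.+1%:R * t)| <=
  \sum_(j < N) `|u j.+1 - u j| + `|u N|.
Proof.
move=> /(@abel_sin_sum R u N t) h.
have -> x y : 2 * `|x| * `|y| = `|2 * x * y| :> R by rewrite !normrM ger0_norm.
have -> : 2 * sin (t / 2) * (\sum_(j < N) u j.+1 * sin (j.+1%:R * t)) =
  \sum_(j < N) (u j.+1 - u j) * cos ((j%:R + 2^-1) * t) - u N * cos ((N%:R + 2^-1) * t).
  by rewrite -h addrK.
apply: (le_trans (ler_normB _ _)); apply: lerD.
  apply: (le_trans (ler_norm_sum _ _ _)); apply: ler_sum => i _.
  by rewrite normrM ler_piMr // cos_max.
by rewrite normrM ler_piMr // cos_max.
Qed.

(** The sequence jumps once, from 0 up to [u p.+1], then falls to [u N]; the fall and the closing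
    [|u N|] together amount to [u p.+1] again. *)
Lemma variation_nonincreasing_tail (R : realType) (u : nat -> R) (p N : nat) : (p < N)%N ->
  (forall j, (j <= p)%N -> u j = 0) ->
  (forall j, (p < j)%N -> (j < N)%N -> u j.+1 <= u j) -> 0 <= u N ->
  \sum_(j < N) `|u j.+1 - u j| + `|u N| <= 2 * u p.+1.
Proof.
move=> pN u0 ud uN.
have up : 0 <= u p.+1.
  apply: (le_trans uN); elim: N pN ud {uN} => // N IH; rewrite ltnS leq_eqVlt.
  move=> /predU1P[<- //|pN] ud; apply: (le_trans (ud _ _ _)) => //.
  by apply: IH => // j pj jN; apply: ud => //; apply: ltnW.
rewrite (ger0_norm uN); move: ud uN; rewrite -(subnK pN) => ud uN.
elim: (N - p.+1)%N ud uN => [|q IH] ud uN.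
  rewrite add0n big_ord_recr /= (u0 p) // subr0 big1 ?add0r; last first.
    by move=> [i /= ip] _; rewrite !u0 ?subr0 ?normr0 // ltnW.
  by rewrite (ger0_norm up) mulr_natl mulr2n.
rewrite addSn big_ord_recr /=.
have h : u (q + p.+1).+1 <= u (q + p.+1)%N by apply: ud; rewrite ?addSn ?ltnS ?leqnn // leq_addl.
have {}IH : \sum_(i < q + p.+1) `|u i.+1 - u i| + u (q + p.+1)%N <= 2 * u p.+1.
  apply: IH; last by apply: le_trans h; rewrite addSn in uN.
  by move=> j pj jq; apply: ud => //; rewrite addSn ltnW.
by rewrite ler0_norm ?subr_le0 // opprB -addrA addrNK.
Qed.

Lemma sin_half_bounds (R : realType) (t c : R) : 0 < t -> t < pi -> t <= c -> c <= pi ->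
  0 < sin (t / 2) <= sin (c / 2).
Proof.
move=> t0 tpi tc cpi; have p0 := pi_gt0 R.
rewrite sin_gt0_pi /=; last by apply/andP; split; lra.
by rewrite leNgt ltr_sin -?leNgt ?ler_pM2r ?in_itv /=; lra.
Qed.

(** Closed form of the sum of [sin (j t) / j] over [j >= 1] for [|t| < 2 pi]. As [Num.sg 0 = 0], the
    value at the jump is the correct 0. *)
Definition sawtooth (R : realType) (t : R) : R := (Num.sg t * pi - t) / 2.

Lemma dirichlet_kernel (R : realType) (N : nat) (t : R) :
  sin (t / 2) * (2 * \sum_(j < N) cos (j.+1%:R * t) + 1) = sin ((N%:R + 2^-1) * t).
Proof.
elim: N => [|N IH]; first by rewrite big_ord0 mulr0 !add0r mulr1 mulrC.
rewrite big_ord_recr /= [2 * _]mulrDr addrAC mulrDr IH.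
have -> : (N%:R + 2^-1) * t = N.+1%:R * t - t / 2 by rewrite -natr1; field.
have -> : (N.+1%:R + 2^-1) * t = N.+1%:R * t + t / 2 by field.
rewrite sinB sinD; ring.
Qed.

Lemma is_derive_sinZ (R : realType) (c x : R) :
  is_derive x 1 (fun y => sin (c * y)) (c * cos (c * x)).
Proof.
have h : is_derive x 1 (c *: (@id R)) c.
  by apply: is_derive_eq; rewrite [_ *: _]mulr1.
by have := is_derive1_comp (is_derive_sin (c * x)) h; rewrite mulrC.
Qed.

Lemma is_derive_cosZ (R : realType) (c x : R) :
  is_derive x 1 (fun y => cos (c * y)) (- (c * sin (c * x))).
Proof.
have h : is_derive x 1 (c *: (@id R)) c.
  by apply: is_derive_eq; rewrite [_ *: _]mulr1.
by have := is_derive1_comp (is_derive_cos (c * x)) h; rewrite mulrC mulrN.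
Qed.

(** The error [F] has the Dirichlet kernel as derivative, up to a factor. Subtracting a term of
    order 1/N, as in an integration by parts, leaves a derivative of order 1/N, and the mean value
    theorem on [[t, pi]] concludes. *)
Lemma sawtooth_cvg_0pi (R : realType) (t : R) : 0 < t -> t < pi ->
  exists c : R, forall N : nat,
  `|sawtooth t - \sum_(j < N) sin (j.+1%:R * t) / j.+1%:R| <= c / N.+1%:R.
Proof.
move=> t0 tpi; set s := sin (t / 2).
have p0 := pi_gt0 R.
have /andP[s0 _] : 0 < s <= s by apply: sin_half_bounds => //; exact: ltW.
(* [s^-1] pays for the subtracted cosine term, and [pi / s ^+ 2] for the mean value bound on
   [G t]. *)
exists (s^-1 + pi / s ^+ 2) => N.
set F := fun x : R => (pi - x) / 2 - \sum_(j < N) sin (j.+1%:R * x) / j.+1%:R.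
set M : R := 2 * N%:R + 1.
have M0 : N.+1%:R <= M by rewrite /M -natr1; have : 0 <= N%:R :> R := ler0n _ N; lra.
have N0 : 0 < N.+1%:R :> R by rewrite ltr0Sn.
have Mp : 0 < M by apply: lt_le_trans M0.
(* By [dirichlet_kernel], [F' = - sin ((N + 1/2) x) / (2 sin (x / 2))]. As [M = 2 (N + 1/2)],
   differentiating the cosine in the correction cancels exactly this; only the derivative of
   [1 / sin (x / 2)] survives, giving [dG]. *)
set G := fun x : R => F x - cos ((N%:R + 2^-1) * x) / (M * sin (x / 2)).
set dG := fun x : R => cos ((N%:R + 2^-1) * x) * cos (x / 2) / (2 * M * sin (x / 2) ^+ 2).
have dF (x : R) : is_derive x 1 F (- 2^-1 - \sum_(j < N) cos (j.+1%:R * x)).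
  have -> : F = (cst (pi / 2) - (2^-1 *: id)) -
      \sum_(j < N) (j.+1%:R^-1 *: (fun y : R => sin (j.+1%:R * y))).
    apply/funext => y; rewrite /F mulrBl
      -[RHS]/(pi / 2 - 2^-1 * y - (\sum_(j < N) (_ *: (fun y : R => sin (j.+1%:R * y)))) y) fct_sumE.
    by congr (_ - _ - _); [rewrite mulrC|apply: eq_bigr => j _; rewrite mulrC].
  apply: is_deriveB; last first.
    apply: is_derive_sum => j.
    have -> : cos (j.+1%:R * x) = j.+1%:R^-1 *: (j.+1%:R * cos (j.+1%:R * x)).
      by rewrite [_ *: _]mulrA mulVf ?mul1r // pnatr_eq0.
    exact/is_deriveZ/is_derive_sinZ.
  by apply: is_derive_eq; rewrite sub0r [_ *: _]mulr1.
have dGP (x : R) : 0 < sin (x / 2) -> is_derive x 1 G (dG x).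
  move=> sx.
  have hx : is_derive x 1 (fun y => M * sin (2^-1 * y)) (M * (2^-1 * cos (2^-1 * x))).
    exact/is_deriveZ/is_derive_sinZ.
  have hi : is_derive x 1 (fun y => (M * sin (2^-1 * y))^-1)
     (- (M * sin (2^-1 * x)) ^- 2 *: (M * (2^-1 * cos (2^-1 * x)))).
    by apply: is_deriveV => //; rewrite mulrC mulf_neq0 // gt_eqF // mulrC.
  have -> : G = F - ((fun y => cos ((N%:R + 2^-1) * y)) * (fun y => (M * sin (2^-1 * y))^-1)).
    by apply/funext => y; rewrite /G /= !fctE [y / 2]mulrC.
  apply: (is_derive_eq (is_deriveB (dF x) (is_deriveM (is_derive_cosZ (N%:R + 2^-1) x) hi))).
  have := dirichlet_kernel N x; rewrite /dG [x / 2]mulrC.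
  rewrite [x / 2]mulrC in sx.
  set S := \sum_(j < N) _ => e.
  rewrite !/GRing.scale /= mulrN -e.
  have Mn : M != 0 by rewrite gt_eqF.
  have -> : N%:R + 2^-1 = M / 2 by rewrite /M; field.
  by field; rewrite Mn gt_eqF.
have Gpi : G pi = 0.
  rewrite /G /F subrr mul0r sub0r big1 => [|j _]; last first.
    have := @sinD2pi R.
    suff -> : sin (j.+1%:R * pi) = 0 :> R by rewrite mul0r.
    have := alternatingn (@sinDpi R) j.+1 0.
    by rewrite add0r sin0 mulr0 mulr_natl.
  have := alternatingn (@cosDpi R) N (pi / 2).
  rewrite cos_pihalf mulr0 => h.
  have -> : (N%:R + 2^-1) * pi = pi / 2 + pi *+ N :> R by rewrite -mulr_natl; ring.
  by rewrite h mul0r oppr0 addr0.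
have [c /andP[tc cpi] hc] : exists2 c, t <= c <= pi & G pi - G t = dG c * (pi - t).
  have dGt x : t <= x <= pi -> is_derive x 1 G (dG x).
    move=> /andP[tx xp]; apply: dGP.
    have /andP[_] := sin_half_bounds t0 tpi tx xp.
    exact: lt_le_trans.
  have [x xt||c] := @MVT_segment R G dG t pi (ltW tpi).
  - by apply: dGt; move: xt; rewrite in_itv /= => /andP[/ltW-> /ltW->].
  - apply: derivable_within_continuous => x; rewrite in_itv /= => xt.
    exact: (@ex_derive _ _ _ _ _ _ (dG x) (dGt x xt)).
  - by rewrite in_itv /=; exists c.
have sc : s <= sin (c / 2) by have /andP[] := sin_half_bounds t0 tpi tc cpi.
have hG : `|G t| <= pi / s ^+ 2 / N.+1%:R.
  have -> : G t = - (dG c * (pi - t)) by rewrite -hc Gpi sub0r opprK.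
  rewrite normrN normrM (ger0_norm (_ : 0 <= pi - t)) ?subr_ge0 ?(ltW tpi) //.
  rewrite mulrC -mulrA; apply: ler_pM => //; rewrite ?subr_ge0 ?(ltW tpi) //.
    by rewrite gerBl ltW.
  rewrite /dG !normrM normfV -invfM.
  have -> : `|2 * M * sin (c / 2) ^+ 2| = 2 * M * sin (c / 2) ^+ 2.
    by rewrite ger0_norm // mulr_ge0 ?sqr_ge0 // mulr_ge0 // ltW.
  apply: (@le_trans _ _ (1 * 1 / (2 * M * sin (c / 2) ^+ 2))).
    apply: ler_wpM2r; last by rewrite ler_pM // cos_max.
    by rewrite invr_ge0 mulr_ge0 ?sqr_ge0 // mulr_ge0 // ltW.
  have sc0 : 0 < sin (c / 2) by apply: lt_le_trans sc.
  rewrite mulr1 mul1r lef_pV2 ?posrE ?mulr_gt0 ?exprn_gt0 //.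
  rewrite mulrC ler_pM ?exprn_ge0 ?(ltW s0) ?(ltW N0) //; first by lra.
  by rewrite ler_pXn2r ?nnegrE // ltW.
have -> : sawtooth t - \sum_(j < N) sin (j.+1%:R * t) / j.+1%:R = G t + cos ((N%:R + 2^-1) * t) / (M * s).
  by rewrite /sawtooth gtr0_sg // mul1r /G /F subrK.
apply: (le_trans (ler_normD _ _)); rewrite [leRHS]mulrDl [leRHS]addrC; apply: lerD => //.
rewrite normrM normfV (ger0_norm (_ : 0 <= M * s)); last by rewrite mulr_ge0 ?ltW.
apply: (@le_trans _ _ (1 / (M * s))).
  by apply: ler_wpM2r; rewrite ?cos_max // invr_ge0 mulr_ge0 // ltW.
by rewrite mul1r -[leRHS]invfM lef_pV2 ?posrE ?mulr_gt0 // [leRHS]mulrC ler_pM2l.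
Qed.

Lemma sawtoothN (R : realType) (t : R) : sawtooth (- t) = - sawtooth t.
Proof. by rewrite /sawtooth sgrN; field. Qed.

(** The reflection [t -> 2 pi - t] carries the interval from [pi] to [2 pi] back to that from 0 to
    [pi], oddness covers negative [t], and at 0 and [pi] every term vanishes. *)
Lemma sawtooth_cvg (R : realType) (t : R) : - (2 * pi) < t -> t < 2 * pi ->
  exists c : R, forall N : nat,
  `|sawtooth t - \sum_(j < N) sin (j.+1%:R * t) / j.+1%:R| <= c / N.+1%:R.
Proof.
have p0 := pi_gt0 R.
have sinNn (j : nat) : sin (j%:R * pi) = 0 :> R.
  have := alternatingn (@sinDpi R) j 0.
  by rewrite add0r sin0 mulr0 mulr_natl.
have odd_ext (x y : R) : sawtooth y = - sawtooth x ->
    (forall j : nat, sin (j.+1%:R * y) = - sin (j.+1%:R * x)) ->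
    (exists c : R, forall N : nat,
    `|sawtooth x - \sum_(j < N) sin (j.+1%:R * x) / j.+1%:R| <= c / N.+1%:R) ->
    exists c : R, forall N : nat,
    `|sawtooth y - \sum_(j < N) sin (j.+1%:R * y) / j.+1%:R| <= c / N.+1%:R.
  move=> sxy hxy [c hc]; exists c => N; rewrite sxy.
  under eq_bigr do rewrite hxy mulNr.
  by rewrite sumrN -opprD normrN.
have pos x : 0 < x -> x < 2 * pi -> exists c : R, forall N : nat,
    `|sawtooth x - \sum_(j < N) sin (j.+1%:R * x) / j.+1%:R| <= c / N.+1%:R.
  move=> x0 x2; have [xp|px|->] := ltgtP x pi; first exact: sawtooth_cvg_0pi.
    apply: (@odd_ext (2 * pi - x)) => [|j|]; last by apply: sawtooth_cvg_0pi; lra.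
      by rewrite /sawtooth !gtr0_sg; [field|lra|lra].
    have -> : j.+1%:R * x = - (j.+1%:R * (2 * pi - x)) + (pi *+ 2) *+ j.+1.
      by rewrite -(mulr_natl (_ *+ 2)) -(mulr_natl pi); ring.
    by rewrite (periodicn (@sinD2pi R)) sinN.
  exists 0 => N; rewrite /sawtooth gtr0_sg // mul1r subrr mul0r mul0r.
  by rewrite big1 ?subr0 ?normr0 // => j _; rewrite sinNn mul0r.
move=> t1 t2; have [t0|t0|->] := ltgtP t 0.
- apply: (@odd_ext (- t)) => [|j|]; first by rewrite sawtoothN opprK.
    by rewrite mulrN sinN opprK.
  by apply: pos; lra.
- exact: pos.
- exists 0 => N; rewrite /sawtooth sgr0 !mul0r subr0 mul0r.
  by rewrite big1 ?subr0 ?normr0 // => j _; rewrite mulr0 sin0 mul0r.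
Qed.

Lemma ler_addr_divn (R : realType) (x y c : R) (p : nat) :
  (forall N, (p <= N)%N -> x <= y + c / N.+1%:R) -> x <= y.
Proof.
move=> h; rewrite leNgt; apply/negP => yx.
have e0 : 0 < x - y by rewrite subr_gt0.
pose N := (maxn p (Num.truncn (c / (x - y)))).
have := h N (leq_maxl _ _).
rewrite -lerBlDl ler_pdivlMr ?ltr0Sn // mulrC -ler_pdivlMr //.
rewrite leNgt => /negP; apply.
apply: (lt_le_trans (truncnS_gt _)).
by rewrite ler_nat ltnS leq_maxr.
Qed.

(** Up to the remainder of the sawtooth series, the error is a sine sum with coefficients
    [(1 - w j) / j], to which [abel_sin_bound] applies; the remainder disappears as [N] grows. *)
Lemma sawtooth_weighted_bound (R : realType) (t K : R) (w : nat -> R) (p q : nat) :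
  - (2 * pi) < t -> t < 2 * pi ->
  (forall j, (p < j)%N -> w j = 0) ->
  (forall N, (q <= N)%N -> \sum_(j < N) `|(1 - w j.+1) / j.+1%:R - (1 - w j) / j%:R|
     + `|(1 - w N) / N%:R| <= 2 * K) ->
  `|sawtooth t - \sum_(j < p) w j.+1 * sin (j.+1%:R * t) / j.+1%:R| <= K / `|sin (t / 2)|.
Proof.
move=> t1 t2 w0 hV; have p0 := pi_gt0 R.
(* At [t = 0] the right side is [K / 0 = 0], and the left side is 0 too. This case serves the points
   [theta = alpha] and [theta = beta]. *)
have [->|tn0] := eqVneq t 0.
  rewrite /sawtooth mul0r sin0 sgr0 !mul0r subr0 mul0r normr0 invr0 mulr0.
  by rewrite big1 ?subr0 ?normr0 // => j _; rewrite mulr0 sin0 mulr0 mul0r.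
have s0 : 0 < `|sin (t / 2)|.
  rewrite normr_gt0; have [tn|tp|/eqP] := ltgtP t 0; last by rewrite (negbTE tn0).
    rewrite -oppr_eq0 -sinN gt_eqF // sin_gt0_pi //; apply/andP; split; lra.
  by rewrite gt_eqF // sin_gt0_pi //; apply/andP; split; lra.
have [c hc] := sawtooth_cvg t1 t2.
apply: (@ler_addr_divn _ _ _ c (maxn p q)) => N; rewrite geq_max => /andP[pN qN].
have -> : \sum_(j < p) w j.+1 * sin (j.+1%:R * t) / j.+1%:R =
    \sum_(j < N) w j.+1 * sin (j.+1%:R * t) / j.+1%:R.
  rewrite -(subnKC pN) big_split_ord /= [X in _ + X]big1 ?addr0 // => j _.
  by rewrite w0 ?mul0r // ltnS leq_addr.
have -> : sawtooth t - \sum_(j < N) w j.+1 * sin (j.+1%:R * t) / j.+1%:R =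
  \sum_(j < N) (1 - w j.+1) / j.+1%:R * sin (j.+1%:R * t) +
  (sawtooth t - \sum_(j < N) sin (j.+1%:R * t) / j.+1%:R).
  rewrite addrCA -sumrN -sumrN -big_split /=; congr (_ + _); apply: eq_bigr => j _.
  by ring.
apply: (le_trans (ler_normD _ _)); apply: lerD (hc N).
rewrite ler_pdivlMr // -(ler_pM2l (_ : 0 < 2)) // [_ * `|sin _|]mulrC mulrA.
apply: le_trans (hV N qN).
by apply: (@abel_sin_bound R (fun j => (1 - w j) / j%:R)); rewrite invr0 mulr0.
Qed.

(** [u1] carries the damping alone and [u2] the truncation after [k']. The numbers [delta j] bound
    the upward steps of [u1]; they will be [m h] times the integral of [Cm_fun] over the j-th
    cell. *)
Lemma weighted_variation_bound (R : realType) (B : R) (d delta : nat -> R) (k' k : nat) :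
  (0 < k')%N -> (k' <= k)%N ->
  d 0%N = 1 -> d k.+1 = 0 ->
  (forall j, (j <= k)%N -> d j.+1 <= d j) ->
  (forall j, (j <= k)%N -> (d j - d j.+1) / j.+1%:R <= delta j) ->
  \sum_(j < k.+1) delta j <= B ->
  let w j := if (j <= k')%N then d j else 0 in
  forall N, (k.+1 <= N)%N ->
  \sum_(j < N) `|(1 - w j.+1) / j.+1%:R - (1 - w j) / j%:R| + `|(1 - w N) / N%:R|
  <= 2 * (d k' / k'.+1%:R + B).
Proof.
move=> k'0 k'k d0 dk dd hdelta hB w N kN.
have dP j : (j <= k.+1)%N -> 0 <= d j.
  suff dS i : (i <= k.+1)%N -> 0 <= d (k.+1 - i)%N.
    by move=> jk; rewrite -(subKn jk) dS // leq_subr.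
  elim: i => [|i IH] ik; first by rewrite subn0 dk.
  apply: (le_trans (IH (ltnW ik))); rewrite ltnS in ik.
  by rewrite subSS (subSn ik) dd // leq_subr.
have d1 j : (j <= k.+1)%N -> d j <= 1.
  elim: j => [|j IH] jk; first by rewrite d0.
  by apply: (le_trans (dd _ _)) => //; apply: IH; exact: ltnW.
(* Nothing is known of [d] past [k.+1], so [e] cuts it off; [d k.+1 = 0] makes the two agree up to
   [k.+1]. *)
pose e j := if (j <= k)%N then d j else 0.
pose u1 j := (1 - e j) / j%:R.
pose u2 j := if (k' < j)%N then e j / j%:R else 0.
have uE j : (1 - w j) / j%:R = u1 j + u2 j.
  rewrite /u1 /u2 /w /e; have [jk'|jk'] := leqP j k'.
    by rewrite (leq_trans jk' k'k) addr0.
  by rewrite -mulrDl subr0 subrK.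
have e0 i : (k < i)%N -> e i = 0 by rewrite /e ltnNge => /negbTE ->.
have ek : e k.+1 = 0 by rewrite e0.
have eE j : (j <= k.+1)%N -> e j = d j.
  by rewrite leq_eqVlt => /predU1P[->|]; rewrite ?ek ?dk // ltnS /e => ->.
have Np : (0 < N)%N by apply: leq_trans kN.
have V1 : \sum_(j < N) `|u1 j.+1 - u1 j| + `|u1 N| <= 2 * B.
  have u1P j : (k < j)%N -> u1 j = j%:R^-1.
    by move=> jk; rewrite /u1 /e leqNgt jk subr0 mul1r.
  (* If [v <= delta] and [0 <= delta], then [|v| <= 2 delta - v], and the sum of the [v] telescopes.
     The gain [u1 k.+1] is spent on the decreasing tail [1 / j] and the closing [|u1 N|]. *)
  have h1 : \sum_(j < k.+1) `|u1 j.+1 - u1 j| <= 2 * B - u1 k.+1.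
    apply: (@le_trans _ _ (\sum_(j < k.+1) (2 * delta j - (u1 j.+1 - u1 j)))).
      apply: ler_sum => -[j /= jk] _; rewrite ltnS in jk.
      have dj := hdelta j jk.
      have dj0 : 0 <= delta j.
        by apply: le_trans dj; rewrite divr_ge0 // subr_ge0 dd.
      suff: u1 j.+1 - u1 j <= delta j by rewrite ler_norml; lra.
      apply: le_trans dj; rewrite /u1 !eE //; last exact: leqW.
      (* Passing to the larger denominator only lowers [u1], so the rise is at most
         [(d j - d j.+1) / j.+1]. At [j = 0], where [1 / 0 = 0], this relies on [d 0 = 1]. *)
      have : (1 - d j) / j.+1%:R <= (1 - d j) / j%:R.
        case: j jk {dj0} => [|j] jk; first by rewrite d0 subrr !mul0r.
        apply: ler_wpM2l; first by rewrite subr_ge0 d1 // leqW.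
        by rewrite lef_pV2 ?posrE ?ltr0Sn // ler_nat.
      move: (j.+1%:R^-1) (j%:R^-1) => x y; lra.
    rewrite sumrB -mulr_sumr.
    have -> : \sum_(j < k.+1) (u1 j.+1 - u1 j) = u1 k.+1.
      rewrite -(big_mkord xpredT (fun j => u1 j.+1 - u1 j)) telescope_sumr //.
      by rewrite /u1 invr0 mulr0 subr0.
    by rewrite lerD2r ler_pM2l.
  have h2 : \sum_(j < N) `|u1 j.+1 - u1 j| = \sum_(j < k.+1) `|u1 j.+1 - u1 j| + (u1 k.+1 - u1 N).
    rewrite -(subnKC kN) big_split_ord /=; congr (_ + _).
    elim: (N - k.+1)%N => [|i IH]; first by rewrite big_ord0 addn0 subrr.
    rewrite big_ord_recr /= IH addnS distrC ger0_norm; first by ring.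
    rewrite subr_ge0 !u1P ?ltnS ?leq_addr //; last by rewrite leqW // leq_addr.
    by rewrite lef_pV2 ?posrE ?ltr0Sn // ler_nat.
  rewrite h2 ger0_norm; last by rewrite u1P ?invr_ge0.
  lra.
have V2 : \sum_(j < N) `|u2 j.+1 - u2 j| + `|u2 N| <= 2 * (d k' / k'.+1%:R).
  have u2N : u2 N = 0 by rewrite /u2 /e (leqNgt N k) kN mul0r if_same.
  apply: (le_trans (@variation_nonincreasing_tail R u2 k' N _ _ _ _)).
  - exact: leq_trans kN.
  - by move=> j jk'; rewrite /u2 ltnNge jk'.
  - move=> j jk' jN; rewrite /u2 jk' ltnS (ltnW jk').
    have [jk|jk] := leqP j k; last by rewrite !e0 ?mul0r // leqW.
    rewrite !eE ?(leqW jk) //; apply: ler_pM; rewrite ?invr_ge0 ?dP ?dd //.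
    rewrite lef_pV2 ?posrE ?ltr0Sn ?ltr0n ?ler_nat //; exact: leq_ltn_trans jk'.
  - by rewrite u2N.
  (* The jump of [u2] is [d k'.+1 / k'.+1]; monotonicity replaces its numerator by [d k']. *)
  rewrite /u2 ltnSn eE // ler_pM2l // ler_wpM2r ?invr_ge0 //.
  exact: dd.
have -> : 2 * (d k' / k'.+1%:R + B) = 2 * B + 2 * (d k' / k'.+1%:R) by ring.
apply: le_trans (lerD V1 V2); rewrite addrACA -big_split /=.
apply: lerD; last by rewrite uE ler_normD.
apply: ler_sum => j _; rewrite !uE.
by rewrite opprD addrACA ler_normD.
Qed.

(** * Spectral norm of a function of a Hermitian matrix *)

Definition sqnorm2 (R : realType) (n : nat) (x : 'cV[R[i]]_n) : R :=
  \sum_i (complex.Re (x i 0) ^+ 2 + complex.Im (x i 0) ^+ 2).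

Lemma sqnorm2E (R : realType) (n : nat) (x : 'cV[R[i]]_n) :
  (sqnorm2 x)%:C%C = ((map_mx Num.conj x)^T *m x) 0 0.
Proof.
rewrite mxE rmorph_sum /=; apply: eq_bigr => j _.
by rewrite add_Re2_Im2 normCK !mxE mulrC.
Qed.

Lemma sqnorm2_ge0 (R : realType) (n : nat) (x : 'cV[R[i]]_n) : 0 <= sqnorm2 x.
Proof. by apply: sumr_ge0 => j _; rewrite addr_ge0 ?sqr_ge0. Qed.

Lemma sqnorm2_unitary (R : realType) (n : nat) (U : 'M[R[i]]_n) (x : 'cV[R[i]]_n) :
  U \is unitarymx -> sqnorm2 (U *m x) = sqnorm2 x.
Proof.
move=> Uu; apply: complexI; rewrite /= !sqnorm2E.
rewrite map_mxM trmx_mul -mulmxA (mulmxA _ U).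
have -> : (map_mx Num.conj U)^T *m U = 1%:M.
  have /mulmx1C := unitarymxP Uu.
  by rewrite map_trmx.
by rewrite mul1mx.
Qed.

Lemma sqnorm2_diag (R : realType) (n : nat) (d : 'rV[R]_n) (B : R) (x : 'cV[R[i]]_n) :
  (forall j, `|d 0 j| <= B) ->
  sqnorm2 (diag_mx (map_mx (fun y => y%:C%C) d) *m x) <= B ^+ 2 * sqnorm2 x.
Proof.
move=> dB; rewrite mulr_sumr; apply: ler_sum => j _.
have -> : (diag_mx (map_mx (fun y => y%:C%C) d) *m x) j 0 = (d 0 j)%:C%C * x j 0.
  by rewrite mul_diag_mx !mxE.
case: (x j 0) => a b /=; rewrite !mul0r subr0 addr0 !exprMn -mulrDr.
apply: ler_wpM2r; first by rewrite addr_ge0 ?sqr_ge0.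
by rewrite -(real_normK (num_real (d 0 j))) ler_pXn2r ?nnegrE //
  (le_trans _ (dB j)).
Qed.

Lemma mxfunB (R : realType) (n : nat) (f g : R -> R) (V : 'M[R[i]]_n) (lam : 'rV[R]_n) :
  mxfun f V lam - mxfun g V lam = mxfun (fun x => f x - g x) V lam.
Proof.
rewrite /mxfun -mulmxBl -mulmxBr -raddfB; congr (_ *m diag_mx _ *m _).
by apply/matrixP => i j; rewrite !mxE rmorphB.
Qed.

(** [V] and its adjoint preserve the Euclidean norm, so only the diagonal factor can stretch a
    vector. *)
Lemma specnorm_mxfun_le (R : realType) (n : nat) (f : R -> R) (V : 'M[R[i]]_n)
    (lam : 'rV[R]_n) (B : R) : V \is unitarymx -> 0 <= B ->
  (forall j, `|f (lam 0 j)| <= B) -> specnorm (mxfun f V lam) <= B.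
Proof.
move=> Vu B0 fB; rewrite /specnorm; set S := [set _ | _ in _]%classic.
have ubS : ubound S B.
  move=> _ [x /= x1 <-].
  rewrite -[leRHS]ger0_norm // -sqrtr_sqr; apply: ler_wsqrtr.
  rewrite -/(sqnorm2 _) /mxfun -!mulmxA sqnorm2_unitary //.
  have -> : map_mx (fun y => (f y)%:C%C) lam = map_mx (fun y => y%:C%C) (map_mx f lam).
    by apply/matrixP => i j; rewrite !mxE.
  apply: (@le_trans _ _ (B ^+ 2 * sqnorm2 ((map_mx Num.conj V)^T *m x))).
    by apply: sqnorm2_diag => j; rewrite mxE.
  rewrite sqnorm2_unitary; last by rewrite map_trmx trmxC_unitary.
  have -> : sqnorm2 x = vnorm2 x ^+ 2 by rewrite sqr_sqrtr ?sqnorm2_ge0.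
  by rewrite x1 expr1n mulr1.
(* Without unit vectors the set is empty and [sup] takes its default value 0, whence [0 <= B]. *)
have [S0|S0] := pselect (nonempty S); first exact: ge_sup.
by rewrite sup_out // => -[].
Qed.

(** * The damping factors and the integral C_m *)

(** The expression vanishes at 0 and has derivative [x sin x]. It gives the sign of the integrand of
    [Cm] and of the derivative of [sin x / x]. *)
Lemma sin_sub_xcos_ge0 (R : realType) (x : R) : 0 <= x <= pi -> 0 <= sin x - x * cos x.
Proof.
move=> /andP[x0 xpi].
have df (y : R) : is_derive y 1 (@sin R - id * (@cos R)) (y * sin y).
  by apply: is_derive_eq; rewrite /GRing.scale /=; ring.
have [|c] := @MVT_segment R (@sin R - id * (@cos R)) (fun y => y * sin y) 0 x x0.
- apply: derivable_within_continuous => y _; exact: (@ex_derive _ _ _ _ _ _ _ (df y)).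
- rewrite in_itv /= => /andP[c0 cx].
  have -> : (@sin R - id * (@cos R)) 0 = 0.
    by apply/eqP; rewrite subr_eq0; apply/eqP; rewrite sin0 [RHS]mul0r.
  rewrite !subr0 -[sin x - x * cos x]/((@sin R - id * (@cos R)) x) => ->.
  by rewrite mulr_ge0 //= mulr_ge0 // sin_ge0_pi // c0 (le_trans cx).
Qed.

Lemma sin_eq_cos_mul (R : realType) (x : R) : 0 <= x ->
  exists2 c, 0 <= c <= x & sin x = cos c * x.
Proof.
move=> x0; have [|c] := @MVT_segment R (@sin R) (@cos R) 0 x x0.
- by apply: derivable_within_continuous => y _; exact: derivable_sin.
- by rewrite in_itv /= sin0 !subr0 => cx e; exists c.
Qed.

Lemma sin_le_id (R : realType) (x : R) : 0 <= x -> sin x <= x.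
Proof.
move=> x0; have [c _ ->] := sin_eq_cos_mul x0.
by rewrite ler_piMl // cos_le1.
Qed.

(** Crude, but enough to make [sin x / x] tend to 1 at 0: [cos c >= 1 - c^2 / 2 >= 1 - x] for
    [0 <= c <= x <= 1]. *)
Lemma sin_ge_mul_onem (R : realType) (x : R) : 0 <= x <= 1 -> (1 - x) * x <= sin x.
Proof.
move=> /andP[x0 x1]; have [c /andP[c0 cx] ->] := sin_eq_cos_mul x0.
apply: ler_wpM2r => //.
have -> : c = (c / 2) *+ 2 by rewrite mulr2n; field.
rewrite cos_mulr2n cos2sin2.
have s1 := @sin_le_id R (c / 2).
have s0 : 0 <= sin (c / 2) by apply: sin_ge0_pi; have := pi_ge2 R; lra.
nra.
Qed.

Lemma is_derive_sinc (R : realType) (x : R) : x != 0 ->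
  is_derive x 1 (fun y => sin y / y) (- ((sin x - x * cos x) / x ^+ 2)).
Proof.
move=> x0; have hi := is_deriveV x0 (is_derive_id x 1).
apply: (is_derive_eq (is_deriveM (is_derive_sin x) hi)).
by rewrite /GRing.scale /=; field.
Qed.

Lemma sinc_nonincreasing (R : realType) (x y : R) : 0 < x -> x <= y -> y <= pi ->
  sin y / y <= sin x / x.
Proof.
move=> x0 xy ypi.
have dz z : x <= z -> is_derive z 1 (fun y => sin y / y) (- ((sin z - z * cos z) / z ^+ 2)).
  by move=> xz; apply: is_derive_sinc; rewrite gt_eqF // (lt_le_trans x0).
have [z||c] := @MVT_segment R (fun y => sin y / y)
  (fun z => - ((sin z - z * cos z) / z ^+ 2)) x y xy.
- by rewrite in_itv /= => /andP[/ltW xz _]; exact: dz.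
- apply: derivable_within_continuous => z; rewrite in_itv /= => /andP[xz _].
  exact: (@ex_derive _ _ _ _ _ _ _ (dz z xz)).
- rewrite in_itv /= => /andP[xc cy] e; rewrite -subr_le0 e mulNr oppr_le0.
  rewrite mulr_ge0 ?subr_ge0 // divr_ge0 ?sqr_ge0 // sin_sub_xcos_ge0 //.
  by rewrite (le_trans (ltW x0) xc) (le_trans cy).
Qed.

(* Extended by continuity to 0, where powR (sin 0 / 0) m would be the junk value 0;
   then dcoef m j k = jackson m (j pi / (k + 1)) for all j. *)
Definition jackson (R : realType) (m x : R) : R :=
  if x == 0 then 1 else powR (sin x / x) m.

Lemma jackson_nonincreasing (R : realType) (m x y : R) : 0 <= m -> 0 <= x -> x <= y -> y <= pi ->
  jackson m y <= jackson m x.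
Proof.
move=> m0 x0 xy ypi; rewrite /jackson.
have sc z : 0 < z -> z <= pi -> 0 <= sin z / z.
  by move=> z0 zpi; rewrite divr_ge0 ?(ltW z0) // sin_ge0_pi // (ltW z0).
have [_|xn0] := eqVneq x 0.
  have [//|yn0] := eqVneq y 0.
  have y0 : 0 < y by rewrite lt_neqAle eq_sym yn0 (le_trans x0).
  have <- : 1 `^ m = 1 :> R by rewrite powR1.
  by apply: ge0_ler_powR; rewrite ?nnegrE ?sc // ler_pdivrMr // mul1r sin_le_id // ltW.
have {}x0 : 0 < x by rewrite lt_neqAle eq_sym xn0.
have y0 : 0 < y by apply: lt_le_trans xy.
rewrite gt_eqF //; apply: ge0_ler_powR; rewrite ?nnegrE ?sc ?(le_trans xy) //.
exact: sinc_nonincreasing.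
Qed.

Definition Cm_fun (R : realType) (m u : R) : R :=
  powR (sin u) (m - 1) * (sin u - u * cos u) / powR u (m + 2).

Lemma Cm_fun_ge0 (R : realType) (m u : R) : 0 <= u <= pi -> 0 <= Cm_fun m u.
Proof.
by move=> u0; rewrite /Cm_fun divr_ge0 ?powR_ge0 // mulr_ge0 ?powR_ge0 // sin_sub_xcos_ge0.
Qed.

Lemma measurable_Cm_fun (R : realType) (m : R) : measurable_fun setT (@Cm_fun R m).
Proof.
rewrite /Cm_fun; under eq_fun do rewrite -powRN.
apply: measurable_funM; last exact: measurable_powR.
have ms : measurable_fun setT (@sin R) by apply: continuous_measurable_fun; exact: continuous_sin.
have mc : measurable_fun setT (@cos R) by apply: continuous_measurable_fun; exact: continuous_cos.
apply: measurable_funM.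
  exact: (measurableT_comp (measurable_powR (m - 1)) ms).
by apply: measurable_funB => //; apply: measurable_funM.
Qed.

(** This identity is where [Cm] comes from: its integrand is the rate of decrease of the damping
    factor, divided by [m x]. *)
Lemma is_derive_jackson (R : realType) (m x : R) : 0 < x < pi ->
  is_derive x 1 (fun y => - powR (sin y / y) m) (m * (x * Cm_fun m x)).
Proof.
move=> /andP[x0 xpi].
have s0 : 0 < sin x by rewrite sin_gt0_pi // x0.
have q0 : 0 < sin x / x by rewrite divr_gt0.
have xn0 : x != 0 by rewrite gt_eqF.
have h := is_deriveN (@is_derive1_comp R (@powR R ^~ m) (fun y => sin y / y) x _ _
  (is_derive1_powR m q0) (is_derive_sinc xn0)).
apply: (is_derive_eq h).
rewrite /Cm_fun powRM ?invr_ge0 ?(ltW s0) ?(ltW x0) //.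
rewrite -(powR_inv1 (ltW x0)) -powRrM mulN1r powRN.
(* All real powers of [x] are expressed through [x^(m - 1)], which [field] then treats as an
   atom. *)
have -> : x `^ (m + 2) = x `^ (m - 1) * x ^+ 3.
  by rewrite -(powR_mulrn 3 (ltW x0)) -powRD ?xn0 ?implybT //; congr (_ `^ _); ring.
have : x `^ (m - 1) != 0 by rewrite gt_eqF // powR_gt0.
move: (x `^ (m - 1)) => X X0.
by field; apply/andP.
Qed.

Lemma continuous_Cm_fun (R : realType) (m x : R) : 0 < x < pi ->
  {for x, continuous (@Cm_fun R m)}.
Proof.
move=> /andP[x0 xpi]; have s0 : 0 < sin x by rewrite sin_gt0_pi // x0.
have cpow (p y : R) : 0 < y -> {for y, continuous (@powR R ^~ p)}.
  move=> y0; apply/differentiable_continuous/derivable1_diffP.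
  by apply: derivable_powR; rewrite in_itv /= y0.
rewrite /Cm_fun; apply: cvgM.
  apply: cvgM.
    exact: (continuous_comp (@continuous_sin R x) (cpow (m - 1) _ s0)).
  apply: cvgB; first exact: continuous_sin.
  by apply: cvgM; [exact: cvg_id|exact: continuous_cos].
by apply: cvgV; [rewrite gt_eqF // powR_gt0|exact: cpow].
Qed.

(** The fundamental theorem of calculus writes the drop as the integral of [m u Cm_fun m u], and
    [u <= y]. The strict bounds avoid 0, where the quotient is undefined, and [pi], near which the
    integrand is unbounded if [m < 1]. *)
Lemma jackson_sub_le_integral_oo (R : realType) (m x y : R) :
  0 <= m -> 0 < x -> x < y -> y < pi ->
  ((jackson m x - jackson m y)%:E <=
   (m * y)%:E * \int[@lebesgue_measure R]_(u in `[x, y]%classic) (Cm_fun m u)%:E)%E.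
Proof.
move=> m0 x0 xy ypi; have y0 : 0 < y by apply: lt_trans xy.
have sub z : x <= z <= y -> 0 < z < pi.
  by move=> /andP[xz zy]; rewrite (lt_le_trans x0 xz) (le_lt_trans zy ypi).
pose G := fun u => - powR (sin u / u) m.
have dG u : x <= u <= y -> is_derive u 1 G (m * (u * Cm_fun m u)).
  by move=> /sub; exact: is_derive_jackson.
have derG u : x <= u <= y -> derivable G u 1.
  by move=> /dG h; exact: (@ex_derive _ _ _ _ _ _ _ h).
have cG u : x <= u <= y -> {for u, continuous G}.
  by move=> /derG h; apply/differentiable_continuous/derivable1_diffP.
have FTC : (\int[@lebesgue_measure R]_(u in `[x, y]%classic) (m * (u * Cm_fun m u))%:E
    = (G y)%:E - (G x)%:E)%E.
  apply: continuous_FTC2 => //.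
  - apply: continuous_in_subspaceT => u; rewrite inE /= in_itv /= => uxy.
    apply: cvgM; first exact: cvg_cst.
    apply: cvgM; first exact: cvg_id.
    by apply: continuous_Cm_fun; exact: sub.
  - split.
    + by move=> u; rewrite in_itv /= => /andP[/ltW xu /ltW uy]; apply: derG; rewrite xu.
    + by apply: cvg_at_right_filter; apply: cG; rewrite lexx ltW.
    + by apply: cvg_at_left_filter; apply: cG; rewrite lexx andbT ltW.
  - move=> u; rewrite in_itv /= => /andP[/ltW xu /ltW uy].
    have uxy : x <= u <= y by rewrite xu.
    by rewrite derive1E; exact: (@derive_val _ _ _ _ _ _ _ (dG u uxy)).
have -> : ((jackson m x - jackson m y)%:E = (G y)%:E - (G x)%:E)%E.
  by rewrite -EFinB /G /jackson !gt_eqF // opprK addrC.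
have mC : measurable_fun `[x, y]%classic (@Cm_fun R m).
  by apply: measurable_funTS; exact: measurable_Cm_fun.
have C0 u : `[x, y]%classic u -> 0 <= Cm_fun m u.
  rewrite /= in_itv /= => /sub /andP[u0 upi].
  by apply: Cm_fun_ge0; rewrite !ltW.
have mCE : measurable_fun `[x, y]%classic (fun u => (Cm_fun m u)%:E) by exact/measurable_EFinP.
have my0 : (0 <= (m * y)%:E)%E by rewrite lee_fin mulr_ge0 // ltW.
have CE0 u : `[x, y]%classic u -> (0 <= (Cm_fun m u)%:E)%E by move=> /C0.
have := ge0_integralZl (@lebesgue_measure R) (measurable_itv _) mCE CE0 my0.
rewrite -FTC => <-.
apply: ge0_le_integral => //.
- move=> u xu; rewrite lee_fin mulr_ge0 // mulr_ge0 ?C0 //.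
  by move: xu; rewrite /= in_itv /= => /sub /andP[/ltW].
- apply/measurable_EFinP; apply: measurable_funM => //; exact: measurable_funM.
- exact: measurable_funeM.
- move=> u xu; rewrite -EFinM lee_fin -mulrA ler_wpM2l // ler_wpM2r ?C0 //.
  by move: xu; rewrite /= in_itv /= => /andP[].
Qed.

Lemma jackson_lt (R : realType) (m x e : R) : 0 < m -> 0 < x -> x < pi -> 0 < e ->
  exists2 y, x < y < pi & jackson m y <= e.
Proof.
move=> m0 x0 xpi e0; pose eta := e `^ m^-1.
have eta0 : 0 < eta by rewrite powR_gt0.
(* The second bound gives [x < pi - r], and the first then gives
   [sin (pi - r) / (pi - r) <= r / x <= eta], the m-th root of [e]. *)
pose r := Num.min (eta * x) ((pi - x) / 2).
have r0 : 0 < r by rewrite lt_min mulr_gt0 //=; lra.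
have r1 : r <= eta * x by rewrite ge_min lexx.
have r2 : r <= (pi - x) / 2 by rewrite ge_min lexx orbT.
exists (pi - r); first by lra.
have y0 : 0 < pi - r by lra.
rewrite /jackson gt_eqF //.
have -> : e = eta `^ m by rewrite /eta -powRrM mulVf ?gt_eqF // powRr1 // ltW.
have -> : sin (pi - r) = sin r.
  by rewrite -(opprK (sin r)) -sinN -sinDpi addrC.
have sr := sin_le_id (ltW r0).
apply: ge0_ler_powR; rewrite ?nnegrE ?(ltW m0) ?(ltW eta0) //.
  by rewrite divr_ge0 ?(ltW y0) // sin_ge0_pi //; apply/andP; split; lra.
rewrite ler_pdivrMr //; apply: (le_trans sr); apply: (le_trans r1).
by rewrite ler_pM2l //; lra.
Qed.

Lemma jackson_gt (R : realType) (m y e : R) : 0 < m -> 0 < y -> 0 < e ->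
  exists2 x, 0 < x < y & 1 - e <= jackson m x.
Proof.
move=> m0 y0 e0.
(* Makes [1 - e] positive, so that it has an m-th root [eta] in the open unit interval. *)
wlog e1 : e e0 / e < 1.
  move=> H; have [/H|e1] := ltP e 1; first exact.
  have [|//|x xy hx] := H (2^-1); first by lra.
    by rewrite invf_lt1 //; lra.
  by exists x => //; apply: le_trans hx; lra.
pose eta := (1 - e) `^ m^-1.
have eta0 : 0 < eta by rewrite powR_gt0 // subr_gt0.
have eta1 : eta < 1.
  have -> : 1 = 1 `^ m^-1 :> R by rewrite powR1.
  by apply: gt0_ltr_powR; rewrite ?nnegrE ?invr_gt0 //; lra.
(* With [x <= 1 - eta], [sin_ge_mul_onem] yields [sin x / x >= 1 - x >= eta]. *)
pose x := Num.min (1 - eta) (y / 2).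
have x0 : 0 < x by rewrite lt_min subr_gt0 eta1 /=; lra.
have x1 : x <= 1 - eta by rewrite ge_min lexx.
have x2 : x <= y / 2 by rewrite ge_min lexx orbT.
exists x; first by lra.
rewrite /jackson gt_eqF //.
have -> : 1 - e = eta `^ m by rewrite /eta -powRrM mulVf ?gt_eqF // powRr1 //; lra.
have le1 : eta <= sin x / x.
  rewrite ler_pdivlMr //; have : (1 - x) * x <= sin x by apply: sin_ge_mul_onem; lra.
  by apply: le_trans; rewrite ler_pM2r //; lra.
by apply: ge0_ler_powR; rewrite ?nnegrE ?(ltW m0) ?(ltW eta0) // (le_trans (ltW eta0)).
Qed.

Lemma jackson_0 (R : realType) (m : R) : jackson m 0 = 1.
Proof. by rewrite /jackson eqxx. Qed.

Lemma jackson_pi (R : realType) (m : R) : m != 0 -> jackson m pi = 0.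
Proof. by move=> m0; rewrite /jackson gt_eqF ?pi_gt0 // sinpi mul0r powR0. Qed.

Lemma le_integral_Cm_fun (R : realType) (m x y x' y' : R) : 0 <= x -> x <= x' -> y' <= y -> y <= pi ->
  (\int[@lebesgue_measure R]_(u in `[x', y']%classic) (Cm_fun m u)%:E <=
   \int[@lebesgue_measure R]_(u in `[x, y]%classic) (Cm_fun m u)%:E)%E.
Proof.
move=> x0 xx yy ypi; apply: ge0_subset_integral => //.
- by apply/measurable_EFinP; apply: measurable_funTS; exact: measurable_Cm_fun.
- move=> u; rewrite /= in_itv /= => /andP[xu uy].
  by rewrite lee_fin Cm_fun_ge0 // (le_trans x0 xu) (le_trans uy).
- by apply: subset_itv; rewrite bnd_simp.
Qed.

(** An endpoint at 0 or [pi] is moved inside at a cost of [e / 2], by [jackson_gt] or [jackson_lt];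
    shrinking the interval can only lower the integral of the nonnegative [Cm_fun]. *)
Lemma jackson_sub_le_integral (R : realType) (m x y : R) :
  0 < m -> 0 <= x -> x < y -> y <= pi ->
  ((jackson m x - jackson m y)%:E <=
   (m * y)%:E * \int[@lebesgue_measure R]_(u in `[x, y]%classic) (Cm_fun m u)%:E)%E.
Proof.
move=> m0 x0 xy ypi.
set I := integral _ _ _; have y0 : 0 < y by apply: le_lt_trans xy.
have I0 : (0 <= I)%E.
  apply: integral_ge0 => u; rewrite /= in_itv /= => /andP[xu uy].
  by rewrite lee_fin Cm_fun_ge0 // (le_trans x0 xu) (le_trans uy).
apply/lee_addgt0Pr => e e0.
have e2 : 0 < e / 2 by rewrite divr_gt0.
have [x1 /andP[xx1 x1y] hx1] : exists2 x1, x <= x1 < y & 0 < x1 /\ jackson m x - e / 2 <= jackson m x1.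
  have [->|xn0] := eqVneq x 0.
    have [x1 /andP[x10 x1y] h] := jackson_gt m0 y0 e2.
    by exists x1; rewrite ?jackson_0 ?(ltW x10).
  by exists x; rewrite ?lexx // lt_neqAle eq_sym xn0 x0; split => //; lra.
have [x10 {}hx1] := hx1.
have [y1 /andP[x1y1 y1y] [y1pi hy1]] : exists2 y1, x1 < y1 <= y & y1 < pi /\ jackson m y1 <= jackson m y + e / 2.
  have [ye|yn] := eqVneq y pi.
    have [|y1 /andP[y1x y1pi] h] := jackson_lt m0 x10 _ e2; first by rewrite -ye.
    exists y1; first by rewrite y1x ye ltW.
    by rewrite ye jackson_pi ?gt_eqF // add0r.
  exists y; first by rewrite x1y lexx.
  by split; [rewrite lt_neqAle yn|lra].
have h := jackson_sub_le_integral_oo (ltW m0) x10 x1y1 y1pi.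
have {}h : ((jackson m x1 - jackson m y1)%:E <= (m * y)%:E * I)%E.
  apply: (le_trans h); apply: lee_pmul.
  - by rewrite lee_fin mulr_ge0 ?ltW // (lt_trans x10).
  - apply: integral_ge0 => u; rewrite /= in_itv /= => /andP[xu uy].
    by rewrite lee_fin Cm_fun_ge0 // (le_trans (ltW x10) xu) (le_trans uy (ltW y1pi)).
  - by rewrite lee_fin ler_pM2l.
  - exact: le_integral_Cm_fun.
apply: (@le_trans _ _ ((jackson m x1 - jackson m y1)%:E + e%:E)%E); last by rewrite leeD2r.
by rewrite -EFinD lee_fin; lra.
Qed.

Lemma integral_Cm_fun_partition (R : realType) (m : R) (x : nat -> R) (n : nat) :
  0 <= x 0%N -> {homo x : i j / (i <= j)%N >-> i <= j} -> x n <= pi ->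
  (\int[@lebesgue_measure R]_(u in `[x 0%N, x n]%classic) (Cm_fun m u)%:E =
   \sum_(j < n) \int[@lebesgue_measure R]_(u in `[x j, x j.+1]%classic) (Cm_fun m u)%:E)%E.
Proof.
move=> x0 xm; elim: n => [|n IH] xn.
  by rewrite big_ord0 set_itv1 integral_set1.
have mC (D : set R) : measurable_fun D (fun u => (Cm_fun m u)%:E).
  by apply/measurable_EFinP; apply: measurable_funTS; exact: measurable_Cm_fun.
rewrite big_ord_recr /= -IH; last by apply: (le_trans (xm _ _ (leqnSn n))).
(* Dropping the left endpoint keeps the integral and makes the new cell disjoint from the earlier
   ones. *)
rewrite -(@integral_itv_obnd_cbnd _ (x n)) //.
have U : (`[x 0%N, x n] `|` `]x n, x n.+1] = `[x 0%N, x n.+1])%classic.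
  by rewrite -itv_bndbnd_setU // bnd_simp; exact: xm.
rewrite -U ge0_integral_setU ?U //; first exact: mC.
- move=> u; rewrite /= in_itv /= => /andP[xu uy].
  by rewrite lee_fin Cm_fun_ge0 // (le_trans x0 xu) (le_trans uy).
- apply/disj_setPS => u [] /=; rewrite !in_itv /= => /andP[_ h] /andP[h' _].
  by move: (lt_le_trans h' h); rewrite ltxx.
Qed.

(** * The pointwise estimate *)

Lemma dcoefE (R : realType) (m : R) (j k : nat) : dcoef m j k = jackson m (j%:R * pi / k.+1%:R).
Proof.
rewrite /dcoef /jackson; case: j => [|j] /=; first by rewrite !mul0r eqxx.
by rewrite gt_eqF // divr_gt0 ?ltr0Sn // mulr_gt0 ?pi_gt0 ?ltr0Sn.
Qed.

(** The damping factors sample [jackson] at the nodes [x j = j h]. Since [x k.+1 = pi], the cells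
    partition the domain of the integral and the [delta j] sum to [m h C]. *)
Lemma sawtooth_jackson_bound (R : realType) (m C : R) (k' k : nat) (t : R) :
  0 < m -> (0 < k')%N -> (k' <= k)%N -> Cm m = C%:E -> - (2 * pi) < t -> t < 2 * pi ->
  `|sawtooth t - \sum_(j < k') dcoef m j.+1 k * sin (j.+1%:R * t) / j.+1%:R| <=
  (dcoef m k' k / k'.+1%:R + pi * m * C / k.+1%:R) / `|sin (t / 2)|.
Proof.
move=> m0 k'0 k'k CE t1 t2; have p0 := pi_gt0 R.
pose h : R := pi / k.+1%:R; pose x (j : nat) := j%:R * h.
have h0 : 0 < h by rewrite divr_gt0 ?ltr0Sn.
have xpi : x k.+1 = pi by rewrite /x /h mulrC divfK // pnatr_eq0.
have xm : {homo x : i j / (i <= j)%N >-> i <= j}.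
  by move=> i j ij; rewrite ler_pM2r // ler_nat.
have x0 j : 0 <= x j by rewrite mulr_ge0 // ltW.
have xle j : (j <= k.+1)%N -> x j <= pi by rewrite -xpi => /xm.
pose I j := (\int[@lebesgue_measure R]_(u in `[x j, x j.+1]%classic) (Cm_fun m u)%:E)%E.
have I0 j : (j <= k)%N -> (0 <= I j)%E.
  move=> jk; apply: integral_ge0 => u; rewrite /= in_itv /= => /andP[xu uy].
  by rewrite lee_fin Cm_fun_ge0 // (le_trans (x0 j) xu) (le_trans uy) // xle.
have Ifin j : (j <= k)%N -> I j \is a fin_num.
  move=> jk; rewrite fin_numE; apply/andP; split.
    by rewrite gt_eqF // (lt_le_trans _ (I0 j jk)) // ltNy0.
  rewrite lt_eqF //; apply: (@le_lt_trans _ _ (Cm m)); last by rewrite CE ltry.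
  by apply: le_integral_Cm_fun => //; exact: xle.
have sumI : \sum_(j < k.+1) fine (I j) = C.
  apply: EFin_inj; rewrite -CE -sumEFin.
  transitivity (\sum_(j < k.+1) I j)%E.
    by apply: eq_bigr => -[j jk] _; rewrite fineK // Ifin.
  rewrite -integral_Cm_fun_partition ?xpi //.
  by rewrite /x mul0r.
have -> : \sum_(j < k') dcoef m j.+1 k * sin (j.+1%:R * t) / j.+1%:R =
    \sum_(j < k') (if (j.+1 <= k')%N then dcoef m j.+1 k else 0) * sin (j.+1%:R * t) / j.+1%:R.
  by apply: eq_bigr => -[j /= ->].
apply: (@sawtooth_weighted_bound R t _
  (fun j => if (j <= k')%N then dcoef m j k else 0) k' k.+1) => //.
  by move=> j kj; rewrite leqNgt kj.
have dE j : dcoef m j k = jackson m (x j) by rewrite dcoefE /x /h mulrA.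
apply: (@weighted_variation_bound R _ (fun j => dcoef m j k)
  (fun j => m * h * fine (I j))) => //.
- by rewrite dE xpi jackson_pi // gt_eqF.
- move=> j jk; rewrite !dE jackson_nonincreasing ?(ltW m0) ?xle //; exact: xm.
- move=> j jk; rewrite ler_pdivrMr ?ltr0Sn //.
  (* The factor [y] in [jackson_sub_le_integral] is [x j.+1 = j.+1 h], so it absorbs the denominator
     [j.+1] exactly. *)
  have -> : m * h * fine (I j) * j.+1%:R = m * x j.+1 * fine (I j) by rewrite /x; ring.
  rewrite -lee_fin EFinM fineK ?Ifin // !dE.
  by apply: jackson_sub_le_integral; rewrite ?xle // ltr_pM2r // ltr_nat.
- by rewrite -mulr_sumr sumI /h le_eqVlt; apply/orP; left; apply/eqP; ring.
Qed.

Definition sum_inv_sin (R : realType) (alpha beta theta : R) : R :=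
  `|sin ((theta + alpha) / 2)|^-1 + `|sin ((theta - alpha) / 2)|^-1
  + `|sin ((theta + beta) / 2)|^-1 + `|sin ((theta - beta) / 2)|^-1.

Lemma einv_norm_gt0 (R : realType) (x : R) : (0 < einv `|x|)%E.
Proof.
rewrite /einv; case: eqP => [_|/eqP x0]; first exact: lt0y.
by rewrite lte_fin invr_gt0 lt_neqAle eq_sym x0 normr_ge0.
Qed.

Lemma Jfun_gt0 (R : realType) (alpha beta theta : R) : (0 < Jfun alpha beta theta)%E.
Proof. by rewrite /Jfun; do 2?case: ifP => _; rewrite !adde_gt0 // einv_norm_gt0. Qed.

Lemma einvE (R : realType) (x : R) : (einv x < +oo)%E -> x != 0 /\ einv x = x^-1%:E.
Proof. by rewrite /einv; case: eqVneq => [|x0] //; rewrite ltxx. Qed.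

(* At theta = alpha or beta the real sum_inv_sin has one junk summand 0^-1 = 0,
   which is the summand that J drops there. *)
Lemma Jfun_fin (R : realType) (alpha beta theta : R) :
  alpha != beta -> (Jfun alpha beta theta < +oo)%E ->
  [/\ Jfun alpha beta theta = (sum_inv_sin alpha beta theta)%:E,
     sin ((theta + alpha) / 2) != 0 & sin ((theta + beta) / 2) != 0].
Proof.
move=> ab; rewrite /Jfun /sum_inv_sin.
have pos := einv_norm_gt0.
have finD (x y : \bar R) : (0 < x)%E -> (0 < y)%E -> (x + y < +oo)%E -> (x < +oo)%E /\ (y < +oo)%E.
  by case: x => [x||] //; case: y => [y||] // _ _ _; rewrite !ltry.
have half (x : R) : (x + x) / 2 = x by field.
have [->|ta] := eqVneq theta alpha; [|have [->|tb] := eqVneq theta beta].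
- move=> /finD[]; rewrite ?adde_gt0 // => /finD[] //.
  move=> /einvE[h1 ->] /einvE[h2 ->] /einvE[h3 ->].
  rewrite -!EFinD half subrr mul0r sin0 normr0 invr0 addr0.
  by rewrite normr_eq0 in h1; rewrite normr_eq0 in h2.
- move=> /finD[]; rewrite ?adde_gt0 // => /finD[] //.
  move=> /einvE[h1 ->] /einvE[h2 ->] /einvE[h3 ->].
  rewrite -!EFinD half subrr mul0r sin0 normr0 invr0 addr0 [beta + alpha]addrC.
  rewrite !normr_eq0 in h1 h2; split => //; congr EFin.
  have -> : (beta - alpha) / 2 = - ((alpha - beta) / 2) by field.
  by rewrite sinN normrN; ring.
- move=> /finD[]; rewrite ?adde_gt0 // => /finD[]; rewrite ?adde_gt0 // => /finD[] //.
  move=> /einvE[h1 ->] /einvE[h2 ->] /einvE[h3 ->] /einvE[h4 ->].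
  by rewrite !normr_eq0 in h1 h3.
Qed.

(** The affine parts of the four sawtooths cancel [alpha - beta], leaving half of
    [sg (theta - beta) - sg (theta - alpha)]. The value [1/2] at the endpoints comes from
    [sg 0 = 0]. *)
Lemma s_step_sawtooth (R : realType) (alpha beta theta : R) :
  beta < alpha -> 0 < theta + alpha -> 0 < theta + beta ->
  (if (beta < theta) && (theta < alpha) then 1
   else if (theta == alpha) || (theta == beta) then 2^-1 else 0) =
  (alpha - beta + (sawtooth (theta + alpha) - sawtooth (theta - alpha)
    - sawtooth (theta + beta) + sawtooth (theta - beta))) / pi.
Proof.
move=> ba ta tb; have p0 : (pi : R) != 0 by rewrite gt_eqF // pi_gt0.
have sgp (x y : R) : x < y -> Num.sg (y - x) = 1 by move=> xy; rewrite gtr0_sg ?subr_gt0.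
have sgn (x y : R) : x < y -> Num.sg (x - y) = -1 by move=> xy; rewrite ltr0_sg ?subr_lt0.
rewrite /sawtooth !(gtr0_sg ta) !(gtr0_sg tb).
move: (pi : R) p0 => c c0.
have [tha|ath|tha] := ltgtP theta alpha; rewrite ?andbF ?andbT /=.
- have [bt|tb'|->] := ltgtP beta theta; rewrite ?(sgn _ _ tha).
  + by rewrite sgp //; field.
  + by rewrite sgn //; field.
  + by rewrite subrr sgr0; field.
- have bt : beta < theta by apply: lt_trans ath.
  by rewrite (gt_eqF bt) !sgp //; field.
- by rewrite tha subrr sgr0 sgp //; field.
Qed.

(** The product-to-sum formula for [sin (j alpha) cos (j theta)] gives the same combination as
    [s_step_sawtooth], with damped partial sums in place of sawtooths. *)
Lemma rho_sum_sines (R : realType) (lmin lmax a b m x : R) (k' k : nat) :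
  let alpha := acos (lmap lmin lmax a) in
  let beta := acos (lmap lmin lmax b) in
  let theta := acos (lmap lmin lmax x) in
  let Q t := \sum_(j < k') dcoef m j.+1 k * sin (j.+1%:R * t) / j.+1%:R in
  -1 <= lmap lmin lmax x <= 1 ->
  rho lmin lmax a b m k' k x =
  (alpha - beta + (Q (theta + alpha) - Q (theta - alpha)
    - Q (theta + beta) + Q (theta - beta))) / pi.
Proof.
move=> alpha beta theta Q lx.
rewrite /rho -/alpha -/beta big_ord_recl mulrDl; congr (_ + _).
  by rewrite /ccoef /dcoef /chebT /= !mulr1.
rewrite -!sumrN -!big_split /= mulr_suml; apply: eq_bigr => j _.
have -> : lmap lmin lmax x = cos theta by rewrite acosK // in_itv.
rewrite /bump /= add1n chebT_cos /ccoef /= !mulrDr !mulrN sinD sinB sinD sinB.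
have p0 : (pi : R) != 0 by rewrite gt_eqF // pi_gt0.
move: (pi : R) p0 => c c0.
by field; rewrite c0 nat1r pnatr_eq0.
Qed.

(** The four errors are compared one by one. The claim [alpha != beta] stands apart because
    [Jfun_fin] takes it as input before it can supply the two nonzero sines. *)
Lemma s_step_rho_bound (R : realType) (lmin lmax a b m C x : R) (k' k : nat) :
  lmin < lmax -> lmin <= x <= lmax -> lmin <= a -> a < b -> b <= lmax ->
  0 < m -> (0 < k')%N -> (k' <= k)%N -> Cm m = C%:E ->
  let alpha := acos (lmap lmin lmax a) in
  let beta := acos (lmap lmin lmax b) in
  let theta := acos (lmap lmin lmax x) in
  alpha != beta /\
  (sin ((theta + alpha) / 2) != 0 -> sin ((theta + beta) / 2) != 0 ->
  `|s_step a b x - rho lmin lmax a b m k' k x| <=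
  (dcoef m k' k / (pi * k'.+1%:R) + m / k.+1%:R * C) * sum_inv_sin alpha beta theta).
Proof.
move=> lm xl la ab bl m0 k'0 k'k CE alpha beta theta.
have p0 := pi_gt0 R.
have lmn : lmax - lmin != 0 by rewrite subr_eq0 gt_eqF.
have lmapP y : lmin <= y <= lmax -> -1 <= lmap lmin lmax y <= 1.
  move=> /andP[y1 y2]; rewrite /lmap ler_pdivlMr ?ler_pdivrMr ?subr_gt0 //.
  by apply/andP; split; lra.
have lmapK y z : (lmap lmin lmax y < lmap lmin lmax z) = (y < z).
  by rewrite /lmap ltr_pM2r ?invr_gt0 ?subr_gt0 //; apply/idP/idP; lra.
have th y : lmin <= y <= lmax -> 0 <= acos (lmap lmin lmax y) <= pi.
  by move=> /lmapP h; rewrite acos_ge0 // acos_lepi.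
(* The arccosine reverses order, so the interval from [a] to [b] becomes that from [beta] to
   [alpha]. *)
have lt_th y z : lmin <= y <= lmax -> lmin <= z <= lmax ->
    (acos (lmap lmin lmax y) < acos (lmap lmin lmax z)) = (z < y).
  move=> hy hz; rewrite -ltr_cos ?in_itv /= ?th // !acosK ?lmapK //.
    by rewrite in_itv /= lmapP.
  by rewrite in_itv /= lmapP.
have al : lmin <= a <= lmax by rewrite la (le_trans (ltW ab)).
have bl' : lmin <= b <= lmax by rewrite bl andbT (le_trans la) // ltW.
have eq_th y z : lmin <= y <= lmax -> lmin <= z <= lmax ->
    (acos (lmap lmin lmax y) == acos (lmap lmin lmax z)) = (y == z).
  by move=> hy hz; rewrite !eq_le !leNgt !lt_th // andbC.
have ba : beta < alpha by rewrite lt_th.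
split; first by rewrite gt_eqF.
move=> sa sb.
have /andP[a0 api] := th _ al; have /andP[b0 bpi] := th _ bl'; have /andP[t0 tpi] := th _ xl.
rewrite -/alpha -/beta -/theta in a0 api b0 bpi t0 tpi.
(* The nonzero sine excludes the ends 0 and [2 pi], leaving the range where the sign of [theta + y]
   is 1 and the sawtooth series converges to [sawtooth]. *)
have range y : 0 <= y -> y <= pi -> sin ((theta + y) / 2) != 0 -> 0 < theta + y < 2 * pi.
  move=> y0 ypi s0; apply/andP; split; rewrite lt_neqAle.
    rewrite addr_ge0 // andbT; apply: contra s0 => /eqP <-.
    by rewrite mul0r sin0.
  rewrite (_ : theta + y <= 2 * pi) ?andbT; last by lra.
  apply: contra s0 => /eqP ->.
  by rewrite mulrAC divff // mul1r sinpi.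
have /andP[ta1 ta2] := range _ a0 api sa.
have /andP[tb1 tb2] := range _ b0 bpi sb.
have -> : s_step a b x = (alpha - beta + (sawtooth (theta + alpha) - sawtooth (theta - alpha)
    - sawtooth (theta + beta) + sawtooth (theta - beta))) / pi.
  by rewrite -s_step_sawtooth // /s_step !lt_th // !eq_th // andbC.
pose Q t := \sum_(j < k') dcoef m j.+1 k * sin (j.+1%:R * t) / j.+1%:R.
have -> : rho lmin lmax a b m k' k x = (alpha - beta + (Q (theta + alpha) - Q (theta - alpha)
    - Q (theta + beta) + Q (theta - beta))) / pi by apply: rho_sum_sines; exact: lmapP.
set K := dcoef m k' k / k'.+1%:R + pi * m * C / k.+1%:R.
have bnd t : - (2 * pi) < t -> t < 2 * pi -> `|sawtooth t - Q t| <= K / `|sin (t / 2)|.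
  exact: sawtooth_jackson_bound.
have -> : (dcoef m k' k / (pi * k'.+1%:R) + m / k.+1%:R * C) = K / pi.
  have pn0 : (pi : R) != 0 by rewrite gt_eqF.
  rewrite /K; move: (pi : R) pn0 (dcoef m k' k) => c c0 d.
  by field; rewrite c0 !nat1r !pnatr_eq0.
rewrite -mulrBl normrM (gtr0_norm (_ : 0 < pi^-1)) ?invr_gt0 // mulrAC.
rewrite ler_pM2r ?invr_gt0 //.
have bndD y : 0 < theta + y -> theta + y < 2 * pi ->
    `|sawtooth (theta + y) - Q (theta + y)| <= K / `|sin ((theta + y) / 2)|.
  by move=> y0; apply: bnd; apply: lt_trans y0; rewrite oppr_lt0 mulr_gt0.
have bndB y : 0 <= y -> y <= pi ->
    `|sawtooth (theta - y) - Q (theta - y)| <= K / `|sin ((theta - y) / 2)|.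
  by move=> y0 ypi; apply: bnd; clear - p0 t0 tpi y0 ypi; lra.
rewrite /sum_inv_sin !mulrDr.
apply: (@le_trans _ _ (`|sawtooth (theta + alpha) - Q (theta + alpha)|
  + `|sawtooth (theta - alpha) - Q (theta - alpha)|
  + `|sawtooth (theta + beta) - Q (theta + beta)|
  + `|sawtooth (theta - beta) - Q (theta - beta)|)).
  have tri (x1 x2 x3 x4 : R) : `|x1 - x2 - x3 + x4| <= `|x1| + `|x2| + `|x3| + `|x4|.
    apply: (le_trans (ler_normD _ _)); rewrite lerD2r.
    apply: (le_trans (ler_normB _ _)); rewrite lerD2r.
    exact: ler_normB.
  apply: le_trans (tri _ _ _ _); rewrite le_eqVlt; apply/orP; left; apply/eqP.
  by congr (`| _ |); ring.
by apply: lerD; [apply: lerD; [apply: lerD; [apply: bndD|apply: bndB]|apply: bndD]|apply: bndB].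
Qed.

(** * From the pointwise estimate to the spectral norm, in the extended reals *)

Theorem theorem3p4 (R : realType) (n : nat) (A V : 'M[R[i]]_n) (lam : 'rV[R]_n)
    (lmin lmax a b m : R) (k' k : nat) :
  (0 < n)%N ->
  A \is hermsymmx ->
  V \is unitarymx ->
  A = mxfun id V lam ->
  lmin < lmax ->
  (forall j, lmin <= lam 0 j <= lmax) ->
  lmin <= a -> a < b -> b <= lmax ->
  0 < m -> (1 <= k')%N -> (k' <= k)%N ->
  let alpha := acos (lmap lmin lmax a) in
  let beta := acos (lmap lmin lmax b) in
  let P := mxfun (s_step a b) V lam in
  let P' := mxfun (rho lmin lmax a b m k' k) V lam in
  let Jstar := \big[Order.max/-oo%E]_(j < n) Jfun alpha beta (acos (lmap lmin lmax (lam 0 j))) in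
  ((specnorm (P - P'))%:E <=
     (dcoef m k' k / (pi * k'.+1%:R))%:E * Jstar
     + (m / k.+1%:R)%:E * Cm m * Jstar
     + (m * pi ^+ 2 / (3 * k.+1%:R ^+ 2))%:E)%E.
Proof.
move=> n0 _ Vu _ lm laml la ab bl m0 k'0 k'k; cbv zeta.
set alpha := acos (lmap lmin lmax a); set beta := acos (lmap lmin lmax b).
set Jstar := \big[_/_]_(j < n) _.
have p0 := pi_gt0 R.
have k1 : 0 < k.+1%:R :> R by rewrite ltr0Sn.
have JleJstar (j : 'I_n) : (Jfun alpha beta (acos (lmap lmin lmax (lam 0%R j))) <= Jstar)%E.
  exact: le_bigmax.
(* An eigenvalue exists because [0 < n], so the maximum lies above its default [-oo]. *)
have Jstar0 : (0 < Jstar)%E := lt_le_trans (Jfun_gt0 _ _ _) (JleJstar (Ordinal n0)).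
have C0 : (0 <= Cm m)%E.
  by apply: integral_ge0 => u /=; rewrite in_itv /= => u0; rewrite lee_fin; exact: Cm_fun_ge0.
set p := dcoef m k' k / _; set q := m / _; set z := m * _ / _.
(* Strict because [k' < k.+1] keeps the angle below [pi]. A zero factor would turn [0 * +oo] into 0
   and spoil the infinite case. *)
have d0 : 0 < dcoef m k' k.
  rewrite /dcoef gtn_eqF // powR_gt0 // divr_gt0 //; last first.
    by rewrite divr_gt0 // mulr_gt0 // ltr0n.
  rewrite sin_gt0_pi // divr_gt0 ?mulr_gt0 ?ltr0n //=.
  by rewrite ltr_pdivrMr // mulrC ltr_pM2l // ltr_nat.
have pp : 0 < p by rewrite divr_gt0 // mulr_gt0 // ltr0n.
have qp : 0 < q by rewrite divr_gt0.
have zp : 0 <= z by rewrite divr_ge0 ?mulr_ge0 ?exprn_ge0 // ltW.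
(* If [Jstar = +oo], the right side is [+oo]; likewise below for [Cm m = +oo], as [q] and [r] are
   positive. *)
move: Jstar Jstar0 JleJstar => [r||] // r0 Jr; last first.
  rewrite gt0_muley ?lte_fin // addye ?addye ?leey //.
  by rewrite gt_eqF // (lt_le_trans ltNy0) // !mule_ge0 // lee_fin ltW.
case CE: (Cm m) C0 => [C||] // C0; last first.
  by rewrite gt0_muley ?lte_fin // gt0_mulye // -EFinM addey // addye // leey.
rewrite -!EFinM -!EFinD lee_fin; rewrite lee_fin in C0; rewrite lte_fin in r0.
rewrite mxfunB; apply: specnorm_mxfun_le => //.
  exact: addr_ge0 (addr_ge0 (mulr_ge0 (ltW pp) (ltW r0))
    (mulr_ge0 (mulr_ge0 (ltW qp) C0) (ltW r0))) zp.
move=> j; apply: (@le_trans _ _ ((p + q * C) * r)); last by rewrite mulrDl lerDl.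
have [albe H] := s_step_rho_bound lm (laml j) la ab bl m0 k'0 k'k CE.
have [JE s1 s2] := Jfun_fin albe (le_lt_trans (Jr j) (ltry r)).
apply: (le_trans (H s1 s2)); apply: ler_wpM2l.
  exact: addr_ge0 (ltW pp) (mulr_ge0 (ltW qp) C0).
by rewrite -lee_fin -JE.
Qed.
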